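(* Let $(D,\mu,u)$ be an algebra and $T$ a twistor for $D$, and equip $\mathrm{Ker}(\mu)\subseteq D\otimes D$ with the $D^T$-bimodule structure given by $d\rightarrow x=(\mu_{12}\circ T_{13}\circ T_{12})(d\otimes x)$ and $x\leftarrow d=(\mu_{23}\circ T_{13}\circ T_{23})(x\otimes d)$ for $d\in D$, $x\in\mathrm{Ker}(\mu)$. Then the canonical $D$-derivation $\delta:D\to\mathrm{Ker}(\mu)$, $\delta(d)=d\otimes 1-1\otimes d$, is also a $D^T$-derivation from $D^T$ to $\mathrm{Ker}(\mu)$.
   Context: $k$ is a field, $\otimes=\otimes_k$, algebras are associative unital $k$-algebras. $T_{ij}$ denotes $T$ acting on the $i$-th and $j$-th factors of $D\otimes D\otimes D$; $\mu_{12}=\mu\otimes\mathrm{id}_D$, $\mu_{23}=\mathrm{id}_D\otimes\mu$. A twistor for $D$ is a linear map $T:D\otimes D\to D\otimes D$ with $T(1\otimes d)=1\otimes d$, $T(d\otimes 1)=d\otimes 1$ for all $d\in D$ and, on $D\otimes D\otimes D$, $\mu_{23}\circ T_{13}\circ T_{12}=T\circ\mu_{23}$, $\mu_{12}\circ T_{13}\circ T_{23}=T\circ\mu_{12}$, $T_{12}\circ T_{23}=T_{23}\circ T_{12}$. Then $D^T$ denotes the associative algebra on the vector space $D$ with multiplication $d*d'=(\mu\circ T)(d\otimes d')$ and the same unit. The displayed formulas do define a $D^T$-bimodule structure on $\mathrm{Ker}(\mu)$. A $D^T$-derivation is a linear map with $\delta(d*d')=d\rightarrow\delta(d')+\delta(d)\leftarrow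 d'$ for all $d,d'\in D$. *)

(* Defs.v *)
From HB Require Import structures.
From mathcomp Require Import all_boot all_order all_algebra.
From mathcomp Require Import boolp.
From mathcomp Require Import finmap monalg.

Set Implicit Arguments.
Unset Strict Implicit.
Unset Printing Implicit Defensive.

Import GRing.Theory.
Local Open Scope quotient_scope.
Local Open Scope ring_scope.

(* Associative unital k-algebras. MathComp's [algType] cannot be used for this,
   since it excludes the zero algebra; see the instance below. *)
HB.mixin Record Lmodule_isAssocAlgebra (k : fieldType) A
    of GRing.Lmodule k A := {
  aone : A;
  amul : A -> A -> A;
  amulA : associative amul;
  amul1x : left_id aone amul;
  amulx1 : right_id aone amul;
  amulPl : forall (c : k) (a b d : A),
    amul (c *: a + b) d = c *: amul a d + amul b d;
  amulPr : forall (c : k) (a b d : A),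
    amul a (c *: b + d) = c *: amul a b + amul a d
}.

#[short(type="assocAlgType")]
HB.structure Definition AssocAlgebra (k : fieldType) :=
  {A of GRing.Lmodule k A & Lmodule_isAssocAlgebra k A}.

Notation "\1" := aone : ring_scope.
Notation "a ∙ b" := (amul a b) (at level 40, left associativity) : ring_scope.

Section AlgTypeAssocAlgebra.
Variables (k : fieldType) (A : algType k).

Fact algType_mulPl (c : k) (a b d : A) :
  (c *: a + b) * d = c *: (a * d) + b * d.
Proof. by rewrite mulrDl scalerAl. Qed.
Fact algType_mulPr (c : k) (a b d : A) :
  a * (c *: b + d) = c *: (a * b) + a * d.
Proof. by rewrite mulrDr scalerAr. Qed.

HB.instance Definition _ := Lmodule_isAssocAlgebra.Build k A
  (@mulrA A) (@mul1r A) (@mulr1 A) algType_mulPl algType_mulPr.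
End AlgTypeAssocAlgebra.

Local Notation bilin f := (bilinear_for *:%R *:%R f).

(* The tensor product of U and V: the quotient of the free k-module on U * V
   by the submodule spanned by the bilinearity relations. *)
Section Tensor.
Variables (k : fieldType) (U V : lmodType k).

Let pairUV : choiceType := (U * V)%type.
Let freeUV : lmodType k := {malg k[pairUV]}.
Let gen (u : U) (v : V) : freeUV := << ((u, v) : pairUV) >>.

Inductive tensor_rel : freeUV -> Prop :=
| tensor_rel0 : tensor_rel 0
| tensor_relD x y : tensor_rel x -> tensor_rel y -> tensor_rel (x + y)
| tensor_relZ c x : tensor_rel x -> tensor_rel (c *: x)
| tensor_rel_genl c u u' v :
    tensor_rel (gen (c *: u + u') v - (c *: gen u v + gen u' v))
| tensor_rel_genr c u v v' :
    tensor_rel (gen u (c *: v + v') - (c *: gen u v + gen u v')).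

Definition tensor_ideal : {pred freeUV} := fun x => `[< tensor_rel x >].

Lemma tensor_ideal_zmod : zmod_closed tensor_ideal.
Proof.
split; first exact/asboolP/tensor_rel0.
move=> x y /asboolP hx /asboolP hy; apply/asboolP; apply: tensor_relD => //.
by rewrite -scaleN1r; apply: tensor_relZ.
Qed.

HB.instance Definition _ :=
  GRing.isZmodClosed.Build freeUV tensor_ideal tensor_ideal_zmod.

Definition tensor_type : Type := Quotient.quot tensor_ideal.
HB.instance Definition _ := GRing.Zmodule.on tensor_type.
HB.instance Definition _ := EqQuotient.on tensor_type.

Let pi (x : freeUV) : tensor_type := \pi_(Quotient.quot tensor_ideal) x.
Let rep (x : tensor_type) : freeUV := repr (x : Quotient.quot tensor_ideal).

Let repK x : pi (rep x) = x. Proof. exact: reprK. Qed.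
Let piP x y : pi x = pi y <-> tensor_rel (x - y).
Proof.
split; first by move/eqP; rewrite -Quotient.idealrBE => /asboolP.
by move=> h; apply/eqP; rewrite -Quotient.idealrBE; apply/asboolP.
Qed.
Let piD x y : pi (x + y) = pi x + pi y.
Proof. by rewrite /pi !piE. Qed.

Definition tensor_scale (c : k) (x : tensor_type) : tensor_type := pi (c *: rep x).

Let piZ c x : pi (c *: x) = tensor_scale c (pi x).
Proof. by apply/piP; rewrite -scalerBr; apply/tensor_relZ/piP; rewrite repK. Qed.

Lemma tensor_scaleA a b x : tensor_scale a (tensor_scale b x) = tensor_scale (a * b) x.
Proof. by rewrite -[x]repK -!piZ scalerA. Qed.
Lemma tensor_scale1 : left_id 1 tensor_scale.
Proof. by move=> x; rewrite -[x]repK -!piZ scale1r. Qed.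
Lemma tensor_scaleDr : right_distributive tensor_scale +%R.
Proof. by move=> c x y; rewrite -[x]repK -[y]repK -!piZ -!piD -!piZ scalerDr. Qed.
Lemma tensor_scaleDl x : {morph tensor_scale^~ x : a b / a + b}.
Proof. by move=> a b; rewrite -[x]repK -!piZ -!piD scalerDl. Qed.

HB.instance Definition _ := GRing.Zmodule_isLmodule.Build k tensor_type
  tensor_scaleA tensor_scale1 tensor_scaleDr tensor_scaleDl.

Definition tensor : lmodType k := tensor_type.

Definition tpure (u : U) (v : V) : tensor := pi (gen u v).

Lemma tpure_bilinear : bilin tpure.
Proof.
split=> [v c u u'|u c v v'].
  have -> : c *: tpure u v + tpure u' v = pi (c *: gen u v + gen u' v).
    by rewrite piD piZ.
  exact/piP/tensor_rel_genl.
have -> : c *: tpure u v + tpure u v' = pi (c *: gen u v + gen u v').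
  by rewrite piD piZ.
exact/piP/tensor_rel_genr.
Qed.
HB.instance Definition _ :=
  bilinear_isBilinear.Build k U V tensor _ _ tpure tpure_bilinear.

(* x as a sum of pure tensors, see [tdecE] *)
Definition tdec (x : tensor) : seq (U * V) :=
  [seq ((rep x)@_p *: p.1, p.2) | p <- msupp (rep x)].

Lemma tdecE x : x = \sum_(p <- tdec x) tpure p.1 p.2.
Proof.
rewrite big_map /= -{1}[x]repK {1}[rep x]monalgE.
have pi0 : pi 0 = 0 by rewrite /pi !piE.
rewrite (big_morph pi piD pi0); apply: eq_bigr => -[u v] _ /=.
rewrite linearZl_LR /=; have -> : << (rep x)@_(u, v) *g (u, v) >>
  = (rep x)@_(u, v) *: gen u v.
  apply/malgP => p; rewrite mcoeffZ !mcoeffU.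
  by rewrite mulrnAr mulr1.
by rewrite piZ.
Qed.

Section Lift.
Variables (W : lmodType k) (f : {bilinear U -> V -> W}).

Definition tensor_lift (x : tensor) : W :=
  \sum_(p <- msupp (rep x)) (rep x)@_p *: f p.1 p.2.

Let flift (x : freeUV) : W := \sum_(p <- msupp x) x@_p *: f p.1 p.2.

Let fliftw (d : {fset pairUV}) (x : freeUV) : (msupp x `<=` d)%fset ->
  flift x = \sum_(p <- d) x@_p *: f p.1 p.2.
Proof.
move=> le; rewrite /flift (big_fset_incl _ le) //= => p _ np.
by rewrite mcoeff_outdom // scale0r.
Qed.

Let fliftP c x y : flift (c *: x + y) = c *: flift x + flift y.
Proof.
pose d := (msupp x `|` msupp y)%fset.
have hd : (msupp (c *: x + y) `<=` d)%fset.
  apply: (fsubset_trans (msuppD_le _ _)); apply: fsetSU; exact: msuppZ_le.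
rewrite (fliftw hd) (@fliftw d x) ?fsubsetUl // (@fliftw d y) ?fsubsetUr //.
rewrite scaler_sumr -big_split /=; apply: eq_bigr => p _.
by rewrite mcoeffD mcoeffZ scalerDl scalerA.
Qed.

Let flift0 : flift 0 = 0.
Proof. by rewrite /flift msupp0 big_seq_fset0. Qed.

Let flift_gen u v : flift (gen u v) = f u v.
Proof.
rewrite (@fliftw [fset (u, v)]%fset) ?msuppU_le //.
by rewrite big_seq_fset1 mcoeffUU scale1r.
Qed.

Let fliftD x y : flift (x + y) = flift x + flift y.
Proof. by rewrite -[x in LHS]scale1r fliftP scale1r. Qed.
Let fliftZ c x : flift (c *: x) = c *: flift x.
Proof. by rewrite -[_ *: x]addr0 fliftP flift0 addr0. Qed.
Let fliftB x y : flift (x - y) = flift x - flift y.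
Proof. by rewrite fliftD -scaleN1r fliftZ scaleN1r. Qed.

Let flift_rel x : tensor_rel x -> flift x = 0.
Proof.
elim=> {x} [|x y _ hx _ hy|c x _ hx|c u u' v|c u v v'].
- exact: flift0.
- by rewrite fliftD hx hy addr0.
- by rewrite fliftZ hx scaler0.
- by rewrite fliftB fliftP !flift_gen linearPl subrr.
- by rewrite fliftB fliftP !flift_gen linearPr subrr.
Qed.

Let lift_pi x : tensor_lift (pi x) = flift x.
Proof.
apply/eqP; rewrite -subr_eq0 -[tensor_lift _]/(flift _) -fliftB.
by apply/eqP/flift_rel/piP; rewrite repK.
Qed.

Lemma tensor_lift_linear : linear tensor_lift.
Proof.
move=> c x y; rewrite -[x]repK -[y]repK.
have -> : c *: pi (rep x) + pi (rep y) = pi (c *: rep x + rep y).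
  by rewrite piD piZ.
by rewrite !lift_pi fliftP.
Qed.
HB.instance Definition _ :=
  GRing.isLinear.Build k tensor W *:%R tensor_lift tensor_lift_linear.

Lemma tensor_liftE u v : tensor_lift (tpure u v) = f u v.
Proof. by rewrite lift_pi flift_gen. Qed.
End Lift.
End Tensor.

Global Opaque tensor tpure tensor_lift tdec.

Notation "U ⊗ V" := (tensor U V) (at level 40, left associativity).
Notation "u ⊗ₜ v" := (tpure u v) (at level 40, left associativity) : ring_scope.

Section TensorMaps.
Variable k : fieldType.
Implicit Types U V W X : lmodType k.

Lemma tensor_ind U V (P : U ⊗ V -> Prop) :
  (forall u v, P (u ⊗ₜ v)) -> (forall x y, P x -> P y -> P (x + y)) ->
  forall x, P x.
Proof.
move=> Pp PD x; rewrite [x]tdecE; elim: (tdec x) => [|p s IHs].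
  by rewrite big_nil -(linear0l (@tpure k U V) 0); apply: Pp.
by rewrite big_cons; apply: PD.
Qed.

Lemma tensor_ext U V W (f g : {linear U ⊗ V -> W}) :
  (forall u v, f (u ⊗ₜ v) = g (u ⊗ₜ v)) -> f =1 g.
Proof.
by move=> fg; elim/tensor_ind => // x y fgx fgy; rewrite !linearD fgx fgy.
Qed.

Lemma tensor_lin_ext U V W X (F : W -> {linear U ⊗ V -> X}) :
  (forall u v, linear (fun w => F w (u ⊗ₜ v))) ->
  forall x, linear (fun w => F w x).
Proof.
move=> lF x c w w'; elim/tensor_ind: x => [u v|x y hx hy]; first exact: lF.
rewrite (linearD (F _)) (linearD (F w)) (linearD (F w')) hx hy.
by rewrite scalerDr addrACA.
Qed.

Section PureLin.
Variables U V : lmodType k.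
Definition tpurel (v : V) (u : U) : U ⊗ V := u ⊗ₜ v.
Definition tpurer (u : U) (v : V) : U ⊗ V := u ⊗ₜ v.
Fact tpurel_linear v : linear (tpurel v).
Proof. by move=> c u u'; rewrite /tpurel linearPl. Qed.
Fact tpurer_linear u : linear (tpurer u).
Proof. by move=> c v v'; rewrite /tpurer linearPr. Qed.
HB.instance Definition _ v :=
  GRing.isLinear.Build k U (U ⊗ V) *:%R (tpurel v) (tpurel_linear v).
HB.instance Definition _ u :=
  GRing.isLinear.Build k V (U ⊗ V) *:%R (tpurer u) (tpurer_linear u).
End PureLin.

Lemma tensor_extl U V W X (f g : {linear U ⊗ V ⊗ W -> X}) :
  (forall u v w, f (u ⊗ₜ v ⊗ₜ w) = g (u ⊗ₜ v ⊗ₜ w)) -> f =1 g.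
Proof.
move=> fg; apply: tensor_ext => x w.
have /= fgw := @tensor_ext _ _ _ (f \o tpurel w) (g \o tpurel w).
by apply: fgw => u v; apply: fg.
Qed.

Lemma tensor_extr U V W X (f g : {linear U ⊗ (V ⊗ W) -> X}) :
  (forall u v w, f (u ⊗ₜ (v ⊗ₜ w)) = g (u ⊗ₜ (v ⊗ₜ w))) -> f =1 g.
Proof.
move=> fg; apply: tensor_ext => u x.
have /= fgu := @tensor_ext _ _ _ (f \o tpurer u) (g \o tpurer u).
by apply: fgu => v w; apply: fg.
Qed.

Section Map.
Variables (U U' V V' : lmodType k).
Variables (f : {linear U -> U'}) (g : {linear V -> V'}).
Definition tmap_pure (u : U) (v : V) : U' ⊗ V' := f u ⊗ₜ g v.
Fact tmap_pure_bilinear : bilin tmap_pure.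
Proof.
by split=> [v c u u'|u c v v']; rewrite /tmap_pure linearP (linearPl, linearPr).
Qed.
HB.instance Definition _ :=
  bilinear_isBilinear.Build k U V (U' ⊗ V') _ _ tmap_pure tmap_pure_bilinear.
Definition tmap : U ⊗ V -> U' ⊗ V' := tensor_lift tmap_pure.
HB.instance Definition _ := GRing.Linear.on tmap.
Lemma tmapE u v : tmap (u ⊗ₜ v) = f u ⊗ₜ g v.
Proof. exact: tensor_liftE. Qed.
End Map.

Section Swap.
Variables U V : lmodType k.
Definition tswap_pure (u : U) (v : V) : V ⊗ U := v ⊗ₜ u.
Fact tswap_pure_bilinear : bilin tswap_pure.
Proof.
by split=> [v c u u'|u c v v']; rewrite /tswap_pure (linearPl, linearPr).
Qed.
HB.instance Definition _ :=
  bilinear_isBilinear.Build k U V (V ⊗ U) _ _ tswap_pure tswap_pure_bilinear.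
Definition tswap : U ⊗ V -> V ⊗ U := tensor_lift tswap_pure.
HB.instance Definition _ := GRing.Linear.on tswap.
Lemma tswapE u v : tswap (u ⊗ₜ v) = v ⊗ₜ u.
Proof. exact: tensor_liftE. Qed.
End Swap.

Section Assoc.
Variables U V W : lmodType k.

Definition tassoc_pure (x : U ⊗ V) (w : W) : U ⊗ (V ⊗ W) :=
  tmap idfun (tpurel w) x.
Fact tassoc_pure_bilinear : bilin tassoc_pure.
Proof.
split=> [w c x y|x]; first exact: linearP.
apply: (tensor_lin_ext (F := fun w => tmap idfun (tpurel w))) => u v c w w'.
by rewrite /= !tmapE /= /tpurel !linearPr.
Qed.
HB.instance Definition _ := bilinear_isBilinear.Build k (U ⊗ V) W
  (U ⊗ (V ⊗ W)) _ _ tassoc_pure tassoc_pure_bilinear.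
Definition tassoc : U ⊗ V ⊗ W -> U ⊗ (V ⊗ W) := tensor_lift tassoc_pure.
HB.instance Definition _ := GRing.Linear.on tassoc.
Lemma tassocE u v w : tassoc (u ⊗ₜ v ⊗ₜ w) = u ⊗ₜ (v ⊗ₜ w).
Proof. by rewrite /tassoc tensor_liftE /= /tassoc_pure tmapE. Qed.

Definition tassocI_pure (u : U) (x : V ⊗ W) : U ⊗ V ⊗ W :=
  tmap (tpurer u) idfun x.
Fact tassocI_pure_bilinear : bilin tassocI_pure.
Proof.
split=> [x|u c x y]; last exact: linearP.
apply: (tensor_lin_ext (F := fun u => tmap (tpurer u) idfun)) => v w c u u'.
by rewrite /= !tmapE /= /tpurer !linearPl.
Qed.
HB.instance Definition _ := bilinear_isBilinear.Build k U (V ⊗ W)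
  (U ⊗ V ⊗ W) _ _ tassocI_pure tassocI_pure_bilinear.
Definition tassocI : U ⊗ (V ⊗ W) -> U ⊗ V ⊗ W := tensor_lift tassocI_pure.
HB.instance Definition _ := GRing.Linear.on tassocI.
Lemma tassocIE u v w : tassocI (u ⊗ₜ (v ⊗ₜ w)) = u ⊗ₜ v ⊗ₜ w.
Proof. by rewrite /tassocI tensor_liftE /= /tassocI_pure tmapE. Qed.

Lemma tassocK : cancel tassoc tassocI.
Proof.
apply: (@tensor_extl _ _ _ _ (tassocI \o tassoc) idfun) => u v w.
by rewrite /= tassocE tassocIE.
Qed.
Lemma tassocIK : cancel tassocI tassoc.
Proof.
apply: (@tensor_extr _ _ _ _ (tassoc \o tassocI) idfun) => u v w.
by rewrite /= tassocIE tassocE.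
Qed.
End Assoc.
End TensorMaps.

(* Maps on the factors i and j of D ⊗ D ⊗ D, which is read as (D ⊗ D) ⊗ D. *)
Section Legs.
Variables (k : fieldType) (D : assocAlgType k).

Fact amul_bilinear : bilin (@amul k D).
Proof. by split=> [v c u u'|u c v v']; rewrite (amulPl, amulPr). Qed.
HB.instance Definition _ :=
  bilinear_isBilinear.Build k D D D _ _ (@amul k D) amul_bilinear.

Definition mulT : D ⊗ D -> D := tensor_lift (@amul k D).
HB.instance Definition _ := GRing.Linear.on mulT.
Lemma mulTE (a b : D) : mulT (a ⊗ₜ b) = a ∙ b.
Proof. exact: tensor_liftE. Qed.

Definition mul12 : D ⊗ D ⊗ D -> D ⊗ D := tmap mulT idfun.
HB.instance Definition _ := GRing.Linear.on mul12.

Definition mul23 : D ⊗ D ⊗ D -> D ⊗ D := tmap idfun mulT \o @tassoc k D D D.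
HB.instance Definition _ := GRing.Linear.on mul23.

Definition leg12 (T : {linear D ⊗ D -> D ⊗ D}) : D ⊗ D ⊗ D -> D ⊗ D ⊗ D :=
  tmap T idfun.
HB.instance Definition _ T := GRing.Linear.on (leg12 T).

Definition leg23 (T : {linear D ⊗ D -> D ⊗ D}) : D ⊗ D ⊗ D -> D ⊗ D ⊗ D :=
  @tassocI k D D D \o tmap idfun T \o @tassoc k D D D.
HB.instance Definition _ T := GRing.Linear.on (leg23 T).

Definition leg13 (T : {linear D ⊗ D -> D ⊗ D}) : D ⊗ D ⊗ D -> D ⊗ D ⊗ D :=
  leg23 (@tswap k D D) \o leg12 T \o leg23 (@tswap k D D).
HB.instance Definition _ T := GRing.Linear.on (leg13 T).
End Legs.

Record twistor (k : fieldType) (D : assocAlgType k) := Twistor {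
  twistor_map :> {linear D ⊗ D -> D ⊗ D};
  twistor1l : forall d : D, twistor_map (\1 ⊗ₜ d) = \1 ⊗ₜ d;
  twistor1r : forall d : D, twistor_map (d ⊗ₜ \1) = d ⊗ₜ \1;
  twistor_mul23 : forall x : D ⊗ D ⊗ D,
    mul23 (leg13 twistor_map (leg12 twistor_map x)) = twistor_map (mul23 x);
  twistor_mul12 : forall x : D ⊗ D ⊗ D,
    mul12 (leg13 twistor_map (leg23 twistor_map x)) = twistor_map (mul12 x);
  twistor_comm : forall x : D ⊗ D ⊗ D,
    leg12 twistor_map (leg23 twistor_map x) =
    leg23 twistor_map (leg12 twistor_map x)
}.

(* Iterated sums over decompositions of tensors into pure tensors, and
   linearity of expressions built from them. *)
Section Bind.
Variable k : fieldType.
Implicit Types U V W X Y : lmodType k.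

Definition tbind U V W (x : U ⊗ V) (f : U -> V -> W) : W :=
  \sum_(p <- tdec x) f p.1 p.2.

Lemma tbindE U V W (h : {linear U ⊗ V -> W}) x :
  h x = tbind x (fun u v => h (u ⊗ₜ v)).
Proof. by rewrite {1}[x]tdecE linear_sum. Qed.

Lemma linear_tbind U V W X (h : {linear W -> X}) (x : U ⊗ V) f :
  h (tbind x f) = tbind x (fun u v => h (f u v)).
Proof. exact: linear_sum. Qed.

Lemma eq_tbind U V W (x : U ⊗ V) (f g : U -> V -> W) :
  (forall u v, f u v = g u v) -> tbind x f = tbind x g.
Proof. by move=> fg; apply: eq_bigr. Qed.

Lemma tbindC U V X Y W (x : U ⊗ V) (y : X ⊗ Y) (f : U -> V -> X -> Y -> W) :
  tbind x (fun u v => tbind y (f u v)) =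
  tbind y (fun a b => tbind x (fun u v => f u v a b)).
Proof. exact: exchange_big. Qed.

Lemma bilin_intro U V W (f : U -> V -> W) :
  (forall v, linear (f^~ v)) -> (forall u, linear (f u)) -> bilin f.
Proof. by []. Qed.

Lemma tbind_lift U V W (f : U -> V -> W) : bilin f ->
  exists h : {linear U ⊗ V -> W}, (forall u v, h (u ⊗ₜ v) = f u v) /\
    forall x, h x = tbind x f.
Proof.
move=> bf; pose f' : {bilinear U -> V -> W} :=
  HB.pack f (bilinear_isBilinear.Build k U V W _ _ f bf).
pose h : {linear U ⊗ V -> W} := GRing.Linear.clone _ _ _ _ (tensor_lift f') _.
exists h; have hE u v : h (u ⊗ₜ v) = f u v by exact: tensor_liftE.
by split=> // x; rewrite tbindE; apply: eq_tbind.
Qed.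

Lemma lin_bindx U V W X (g : W -> U ⊗ V) (f : U -> V -> X) :
  linear g -> bilin f -> linear (fun w => tbind (g w) f).
Proof.
move=> lg /tbind_lift[h [_ hE]] c x y.
by rewrite -!hE lg linearP.
Qed.

Lemma lin_bindf U V W X (x : U ⊗ V) (f : W -> U -> V -> X) :
  (forall u v, linear (fun w => f w u v)) -> linear (fun w => tbind x (f w)).
Proof.
move=> lf c w w'; rewrite /tbind scaler_sumr -big_split.
by apply: eq_bigr => p _; rewrite lf.
Qed.

Lemma lin_pl U V W (g : W -> U) (v : V) : linear g -> linear (fun w => g w ⊗ₜ v).
Proof. by move=> lg c x y; rewrite lg linearPl. Qed.
Lemma lin_pr U V W (g : W -> V) (u : U) : linear g -> linear (fun w => u ⊗ₜ g w).
Proof. by move=> lg c x y; rewrite lg linearPr. Qed.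
Lemma lin_map U V W (h : {linear U -> V}) (g : W -> U) :
  linear g -> linear (fun w => h (g w)).
Proof. by move=> lg c x y; rewrite lg linearP. Qed.
Lemma lin_ml (A : assocAlgType k) W (g : W -> A) (a : A) :
  linear g -> linear (fun w => g w ∙ a).
Proof. by move=> lg c x y; rewrite lg amulPl. Qed.
Lemma lin_mr (A : assocAlgType k) W (g : W -> A) (a : A) :
  linear g -> linear (fun w => a ∙ g w).
Proof. by move=> lg c x y; rewrite lg amulPr. Qed.
Lemma lin_id W : linear (fun w : W => w).
Proof. by []. Qed.
End Bind.

Ltac lin_step :=
  match goal with
  | |- bilinear_for _ _ _ => apply: bilin_intro => ?
  | |- GRing.linear_for _ (fun w => w) => exact: lin_id
  | |- GRing.linear_for _ (fun w => tpure (@?g w) ?v) => refine (@lin_pl _ _ _ _ g v _)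
  | |- GRing.linear_for _ (fun w => tpure ?v (@?g w)) => refine (@lin_pr _ _ _ _ g v _)
  | |- GRing.linear_for _ (fun w => amul (@?g w) ?v) => refine (@lin_ml _ _ _ g v _)
  | |- GRing.linear_for _ (fun w => amul ?v (@?g w)) => refine (@lin_mr _ _ _ g v _)
  | |- GRing.linear_for _ (fun w => tbind (@?g w) ?f) =>
      refine (@lin_bindx _ _ _ _ _ g f _ _)
  | |- GRing.linear_for _ (fun w => tbind ?x (@?f w)) =>
      refine (@lin_bindf _ _ _ _ _ x f _) => ? ?
  | |- GRing.linear_for _ (fun w => GRing.Linear.sort ?h (@?g w)) =>
      refine (@lin_map _ _ _ _ h g _)
  end; cbv beta.
Ltac lin_tac := repeat lin_step.
Global Opaque tbind.

Section TwistorTheory.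
Variables (k : fieldType) (D : assocAlgType k).
Implicit Types a b c d : D.

Lemma mul12E a b c : mul12 (a ⊗ₜ b ⊗ₜ c) = (a ∙ b) ⊗ₜ c.
Proof. by rewrite /mul12 tmapE /= mulTE. Qed.
Lemma mul23E a b c : mul23 (a ⊗ₜ b ⊗ₜ c) = a ⊗ₜ (b ∙ c).
Proof. by rewrite /mul23 /= tassocE tmapE /= mulTE. Qed.

Section Leg.
Variable T : {linear D ⊗ D -> D ⊗ D}.

Lemma leg12E a b c :
  leg12 T (a ⊗ₜ b ⊗ₜ c) = tbind (T (a ⊗ₜ b)) (fun u v => u ⊗ₜ v ⊗ₜ c).
Proof.
rewrite /leg12 tmapE /=.
by have /= := tbindE (@tpurel k (D ⊗ D) D c) (T (a ⊗ₜ b)).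
Qed.
Lemma leg23E a b c :
  leg23 T (a ⊗ₜ b ⊗ₜ c) = tbind (T (b ⊗ₜ c)) (fun u v => a ⊗ₜ u ⊗ₜ v).
Proof.
rewrite /leg23 /= tassocE tmapE /=.
have /= := tbindE (@tassocI k D D D \o tpurer a) (T (b ⊗ₜ c)).
rewrite {1}/tpurer => ->.
by apply: eq_tbind => u v; rewrite /tpurer tassocIE.
Qed.
End Leg.

Lemma leg23_swapE a b c : leg23 (@tswap k D D) (a ⊗ₜ b ⊗ₜ c) = a ⊗ₜ c ⊗ₜ b.
Proof. by rewrite /leg23 /= tassocE tmapE /= tswapE tassocIE. Qed.

Lemma leg13E (T : {linear D ⊗ D -> D ⊗ D}) a b c :
  leg13 T (a ⊗ₜ b ⊗ₜ c) = tbind (T (a ⊗ₜ c)) (fun u v => u ⊗ₜ b ⊗ₜ v).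
Proof.
rewrite /leg13 /= leg23_swapE leg12E linear_tbind /=.
by apply: eq_tbind => u v /=; rewrite leg23_swapE.
Qed.

Variable T : twistor D.

Lemma twistorMr a b c : T (a ⊗ₜ (b ∙ c)) =
  tbind (T (a ⊗ₜ b)) (fun a1 b1 => tbind (T (a1 ⊗ₜ c)) (fun a2 c1 =>
    a2 ⊗ₜ (b1 ∙ c1))).
Proof.
rewrite -mul23E -twistor_mul23 leg12E !linear_tbind /=.
apply: eq_tbind => u v /=; rewrite leg13E linear_tbind /=.
by apply: eq_tbind => * /=; rewrite mul23E.
Qed.

Lemma twistorMl a b c : T ((a ∙ b) ⊗ₜ c) =
  tbind (T (b ⊗ₜ c)) (fun b1 c1 => tbind (T (a ⊗ₜ c1)) (fun a1 c2 =>
    (a1 ∙ b1) ⊗ₜ c2)).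
Proof.
rewrite -mul12E -twistor_mul12 leg23E !linear_tbind /=.
apply: eq_tbind => u v /=; rewrite leg13E linear_tbind /=.
by apply: eq_tbind => * /=; rewrite mul12E.
Qed.

Lemma tbind_lift3 (W : lmodType k) (F : D -> D -> D -> W) :
  (forall b c, linear (fun a => F a b c)) ->
  (forall a c, linear (fun b => F a b c)) ->
  (forall a b, linear (fun c => F a b c)) ->
  exists h : {linear D ⊗ D ⊗ D -> W}, forall a b c, h (a ⊗ₜ b ⊗ₜ c) = F a b c.
Proof.
move=> l1 l2 l3.
have bf c : bilin (fun a b => F a b c) by split=> ?.
have bG : bilin (fun (x : D ⊗ D) c => tbind x (fun a b => F a b c)).
  split=> [c|x]; last exact: lin_bindf.
  exact: (lin_bindx (@lin_id k (D ⊗ D))).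
have [h [hE _]] := tbind_lift bG; exists h => a b c; rewrite hE.
by have [g [gE <-]] := tbind_lift (bf c).
Qed.

Lemma twistorC (W : lmodType k) (F : D -> D -> D -> W) a b c :
  (forall b c, linear (fun a => F a b c)) ->
  (forall a c, linear (fun b => F a b c)) ->
  (forall a b, linear (fun c => F a b c)) ->
  tbind (T (b ⊗ₜ c)) (fun b1 c1 => tbind (T (a ⊗ₜ b1)) (fun a1 b2 => F a1 b2 c1))
  = tbind (T (a ⊗ₜ b)) (fun a1 b1 => tbind (T (b1 ⊗ₜ c)) (fun b2 c1 => F a1 b2 c1)).
Proof.
move=> l1 l2 l3; have [h hE] := tbind_lift3 l1 l2 l3.
have /(congr1 h) := twistor_comm T (a ⊗ₜ b ⊗ₜ c).
rewrite leg23E leg12E !linear_tbind /=.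
under eq_tbind do rewrite leg12E linear_tbind /=.
under [in RHS]eq_tbind do rewrite leg23E linear_tbind /=.
move=> H.
under eq_tbind do under eq_tbind do rewrite -hE.
rewrite H; apply: eq_tbind => *; apply: eq_tbind => *; exact: hE.
Qed.
End TwistorTheory.

Section TwistedProduct.
Variables (k : fieldType) (D : assocAlgType k) (T : twistor D).
Implicit Types a b c d : D.

Definition twisted_mul a b : D := mulT (T (a ⊗ₜ b)).

Fact twisted_mulE a b :
  twisted_mul a b = tbind (T (a ⊗ₜ b)) (fun u v => u ∙ v).
Proof.
rewrite /twisted_mul (tbindE (@mulT k D)) /=.
by apply: eq_tbind => u v; rewrite mulTE.
Qed.

Fact twisted_mulPl (c : k) a b d :
  twisted_mul (c *: a + b) d = c *: twisted_mul a d + twisted_mul b d.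
Proof. by rewrite /twisted_mul linearPl !linearP. Qed.
Fact twisted_mulPr (c : k) a b d :
  twisted_mul a (c *: b + d) = c *: twisted_mul a b + twisted_mul a d.
Proof. by rewrite /twisted_mul linearPr !linearP. Qed.

Fact twisted_mul1x : left_id \1 twisted_mul.
Proof. by move=> d; rewrite /twisted_mul twistor1l mulTE amul1x. Qed.
Fact twisted_mulx1 : right_id \1 twisted_mul.
Proof. by move=> d; rewrite /twisted_mul twistor1r mulTE amulx1. Qed.

Lemma tbind_linear (U V W X : lmodType k) (g : W -> X) (x : U ⊗ V)
  (f : U -> V -> W) : linear g ->
  g (tbind x f) = tbind x (fun u v => g (f u v)).
Proof.
move=> lg; pose h : {linear W -> X} :=
  HB.pack g (GRing.isLinear.Build k W X *:%R g lg).
exact: (linear_tbind h).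
Qed.

Fact twisted_mulA : associative twisted_mul.
Proof.
move=> a b c; rewrite (twisted_mulE b c) (twisted_mulE a b).
rewrite (tbind_linear (g := twisted_mul a)); last first.
  by move=> r d d'; rewrite twisted_mulPr.
rewrite (tbind_linear (g := fun d => twisted_mul d c)); last first.
  by move=> r d d'; rewrite twisted_mulPl.
have -> : tbind (T (b ⊗ₜ c)) (fun u v => twisted_mul a (u ∙ v)) =
  tbind (T (b ⊗ₜ c)) (fun b1 c1 => tbind (T (a ⊗ₜ b1)) (fun a1 b2 =>
    tbind (T (a1 ⊗ₜ c1)) (fun a2 c2 => a2 ∙ b2 ∙ c2))).
  apply: eq_tbind => u v; rewrite /twisted_mul twistorMr linear_tbind /=.
  apply: eq_tbind => p q; rewrite linear_tbind /=.
  by apply: eq_tbind => r s; rewrite mulTE amulA.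
have -> : tbind (T (a ⊗ₜ b)) (fun u v => twisted_mul (u ∙ v) c) =
  tbind (T (a ⊗ₜ b)) (fun a1 b1 => tbind (T (b1 ⊗ₜ c)) (fun b2 c1 =>
    tbind (T (a1 ⊗ₜ c1)) (fun a2 c2 => a2 ∙ b2 ∙ c2))).
  apply: eq_tbind => u v; rewrite /twisted_mul twistorMl linear_tbind /=.
  apply: eq_tbind => p q; rewrite linear_tbind /=.
  by apply: eq_tbind => r s; rewrite mulTE.
apply: twistorC => ? ?; lin_tac.
Qed.

(* The actions d → x and x ← d, which make sense on all of D ⊗ D. *)
Definition lactT d (x : D ⊗ D) : D ⊗ D :=
  mul12 (leg13 T (leg12 T (@tassocI k D D D (d ⊗ₜ x)))).
Definition ractT (x : D ⊗ D) d : D ⊗ D := mul23 (leg13 T (leg23 T (x ⊗ₜ d))).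

Fact lactT_bilinear : bilin lactT.
Proof.
pose h : {linear D ⊗ (D ⊗ D) -> D ⊗ D} :=
  @mul12 k D \o leg13 T \o leg12 T \o @tassocI k D D D.
apply: bilin_intro => [x|d].
  exact: (lin_map h (lin_pl x (@lin_id k D))).
exact: (lin_map h (lin_pr d (@lin_id k (D ⊗ D)))).
Qed.
Fact ractT_bilinear : bilin ractT.
Proof.
pose h : {linear D ⊗ D ⊗ D -> D ⊗ D} := @mul23 k D \o leg13 T \o leg23 T.
apply: bilin_intro => [d|x].
  exact: (lin_map h (lin_pl d (@lin_id k (D ⊗ D)))).
exact: (lin_map h (lin_pr x (@lin_id k D))).
Qed.

Fact lactTE d a b : lactT d (a ⊗ₜ b) =
  tbind (T (d ⊗ₜ a)) (fun p1 p2 => tbind (T (p1 ⊗ₜ b)) (fun q1 q2 =>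
    (q1 ∙ p2) ⊗ₜ q2)).
Proof.
rewrite /lactT tassocIE leg12E !linear_tbind /=; apply: eq_tbind => u v.
rewrite leg13E linear_tbind /=; apply: eq_tbind => p q; exact: mul12E.
Qed.
Fact ractTE a b d : ractT (a ⊗ₜ b) d =
  tbind (T (b ⊗ₜ d)) (fun p1 p2 => tbind (T (a ⊗ₜ p2)) (fun q1 q2 =>
    q1 ⊗ₜ (p1 ∙ q2))).
Proof.
rewrite /ractT leg23E !linear_tbind /=; apply: eq_tbind => u v.
rewrite leg13E linear_tbind /=; apply: eq_tbind => p q; exact: mul23E.
Qed.

Lemma lin_lact (W : lmodType k) (g : W -> D ⊗ D) d :
  linear g -> linear (fun w => lactT d (g w)).
Proof. by move=> lg c x y; rewrite lg lactT_bilinear. Qed.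
Lemma lin_lactl (W : lmodType k) (g : W -> D) x :
  linear g -> linear (fun w => lactT (g w) x).
Proof. by move=> lg c d d'; rewrite lg lactT_bilinear. Qed.
Lemma lin_ract (W : lmodType k) (g : W -> D ⊗ D) d :
  linear g -> linear (fun w => ractT (g w) d).
Proof. by move=> lg c x y; rewrite lg ractT_bilinear. Qed.
Lemma lin_ractr (W : lmodType k) (g : W -> D) x :
  linear g -> linear (fun w => ractT x (g w)).
Proof. by move=> lg c d d'; rewrite lg ractT_bilinear. Qed.

Lemma tensor_ext_lin (W : lmodType k) (f g : D ⊗ D -> W) :
  linear f -> linear g -> (forall a b, f (a ⊗ₜ b) = g (a ⊗ₜ b)) -> f =1 g.
Proof.
move=> lf lg fg; elim/tensor_ind => // x y hx hy.
by rewrite -[x]scale1r lf lg hx hy.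
Qed.

Lemma tbind_pure (U V W : lmodType k) (f : U -> V -> W) u v :
  bilin f -> tbind (u ⊗ₜ v) f = f u v.
Proof. by move=> /tbind_lift[h [hE <-]]; rewrite hE. Qed.

Fact lactT1 x : lactT \1 x = x.
Proof.
apply: (@tensor_ext_lin _ (lactT \1) id) x => [||a b].
- exact/lin_lact/lin_id.
- exact: lin_id.
rewrite lactTE twistor1l tbind_pure; last by lin_tac.
rewrite twistor1l tbind_pure; last by lin_tac.
by rewrite amul1x.
Qed.

Fact ractT1 x : ractT x \1 = x.
Proof.
apply: (@tensor_ext_lin _ (ractT^~ \1) id) x => [||a b].
- exact/lin_ract/lin_id.
- exact: lin_id.
rewrite ractTE twistor1r tbind_pure; last by lin_tac.
rewrite twistor1r tbind_pure; last by lin_tac.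
by rewrite amulx1.
Qed.

Fact lactTA d d' x : lactT d (lactT d' x) = lactT (twisted_mul d d') x.
Proof.
apply: (@tensor_ext_lin _ (fun x => lactT d (lactT d' x))
  (lactT (twisted_mul d d'))) x => [||a b].
- exact/lin_lact/lin_lact/lin_id.
- exact/lin_lact/lin_id.
rewrite lactTE twisted_mulE.
rewrite (tbind_linear (g := lactT d)); last exact/lin_lact/lin_id.
rewrite (tbind_linear (g := lactT^~ (a ⊗ₜ b))); last exact/lin_lactl/lin_id.
pose F (p2 r1 r2 : D) := tbind (T (r1 ⊗ₜ p2)) (fun v1 v2 =>
  tbind (T (r2 ⊗ₜ b)) (fun u1 u2 =>
  tbind (T (v1 ⊗ₜ u2)) (fun w1 w2 => (w1 ∙ u1 ∙ v2) ⊗ₜ w2))).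
transitivity (tbind (T (d' ⊗ₜ a)) (fun p1 p2 => tbind (T (d ⊗ₜ p1))
  (fun r1 r2 => F p2 r1 r2))).
  apply: eq_tbind => p1 p2.
  rewrite (tbind_linear (g := lactT d)); last exact/lin_lact/lin_id.
  transitivity (tbind (T (p1 ⊗ₜ b)) (fun q1 q2 =>
    tbind (T (d ⊗ₜ q1)) (fun u1 u2 =>
    tbind (T (u1 ⊗ₜ p2)) (fun v1 v2 =>
    tbind (T (v1 ⊗ₜ q2)) (fun w1 w2 => (w1 ∙ u2 ∙ v2) ⊗ₜ w2))))).
    apply: eq_tbind => q1 q2; rewrite lactTE twistorMr.
    rewrite (tbind_linear (g := fun t => tbind t _)); last by lin_tac.
    apply: eq_tbind => u1 u2.
    rewrite (tbind_linear (g := fun t => tbind t _)); last by lin_tac.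
    apply: eq_tbind => v1 v2; rewrite tbind_pure; last by lin_tac.
    by apply: eq_tbind => w1 w2; rewrite amulA.
  rewrite (twistorC T (F := fun u1 u2 q2 =>
    tbind (T (u1 ⊗ₜ p2)) (fun v1 v2 =>
    tbind (T (v1 ⊗ₜ q2)) (fun w1 w2 => (w1 ∙ u2 ∙ v2) ⊗ₜ w2)))).
  - by apply: eq_tbind => r1 r2; rewrite /F tbindC.
  - by move=> ? ?; lin_tac.
  - by move=> ? ?; lin_tac.
  - by move=> ? ?; lin_tac.
rewrite (twistorC T (F := fun r1 r2 p2 => F p2 r1 r2)).
- apply: eq_tbind => r1 r2.
  rewrite lactTE twistorMl.
  rewrite (tbind_linear (g := fun t => tbind t _)); last by lin_tac.
  apply: eq_tbind => p1 p2.
  rewrite (tbind_linear (g := fun t => tbind t _)); last by lin_tac.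
  rewrite /F; apply: eq_tbind => q1 q2; rewrite tbind_pure; last by lin_tac.
  rewrite twistorMl.
  rewrite (tbind_linear (g := fun t => tbind t _)); last by lin_tac.
  apply: eq_tbind => u1 u2.
  rewrite (tbind_linear (g := fun t => tbind t _)); last by lin_tac.
  by apply: eq_tbind => v1 v2; rewrite tbind_pure //; lin_tac.
- by move=> ? ?; rewrite /F; lin_tac.
- by move=> ? ?; rewrite /F; lin_tac.
- by move=> ? ?; rewrite /F; lin_tac.
Qed.

Fact ractTA x d d' : ractT (ractT x d) d' = ractT x (twisted_mul d d').
Proof.
apply: (@tensor_ext_lin _ (fun x => ractT (ractT x d) d')
  (ractT^~ (twisted_mul d d'))) x => [||a b].
- exact/lin_ract/lin_ract/lin_id.
- exact/lin_ract/lin_id.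
rewrite ractTE twisted_mulE.
rewrite (tbind_linear (g := ractT^~ d')); last exact/lin_ract/lin_id.
rewrite (tbind_linear (g := ractT (a ⊗ₜ b))); last exact/lin_ractr/lin_id.
pose F (x y z : D) := tbind (T (x ⊗ₜ z)) (fun q1 q2 =>
  tbind (T (a ⊗ₜ y)) (fun u1 u2 =>
  tbind (T (u1 ⊗ₜ q2)) (fun v1 v2 => v1 ⊗ₜ (q1 ∙ u2 ∙ v2)))).
transitivity (tbind (T (b ⊗ₜ d)) (fun p1 p2 => tbind (T (p2 ⊗ₜ d'))
  (fun r1 r2 => F p1 r1 r2))).
  apply: eq_tbind => p1 p2.
  rewrite (tbind_linear (g := ractT^~ d')); last exact/lin_ract/lin_id.
  transitivity (tbind (T (a ⊗ₜ p2)) (fun q1 q2 =>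
    tbind (T (q2 ⊗ₜ d')) (fun r1 r2 =>
    tbind (T (p1 ⊗ₜ r2)) (fun s1 s2 =>
    tbind (T (q1 ⊗ₜ s2)) (fun v1 v2 => v1 ⊗ₜ (s1 ∙ r1 ∙ v2)))))).
    apply: eq_tbind => q1 q2; rewrite ractTE twistorMl.
    rewrite (tbind_linear (g := fun t => tbind t _)); last by lin_tac.
    apply: eq_tbind => r1 r2.
    rewrite (tbind_linear (g := fun t => tbind t _)); last by lin_tac.
    by apply: eq_tbind => s1 s2; rewrite tbind_pure //; lin_tac.
  rewrite -(twistorC T (F := fun q1 r1 r2 =>
    tbind (T (p1 ⊗ₜ r2)) (fun s1 s2 =>
    tbind (T (q1 ⊗ₜ s2)) (fun v1 v2 => v1 ⊗ₜ (s1 ∙ r1 ∙ v2))))).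
  - by apply: eq_tbind => r1 r2; rewrite /F tbindC.
  - by move=> ? ?; lin_tac.
  - by move=> ? ?; lin_tac.
  - by move=> ? ?; lin_tac.
rewrite -(twistorC T (F := F)).
- apply: eq_tbind => r1 r2.
  rewrite ractTE twistorMr.
  rewrite (tbind_linear (g := fun t => tbind t _)); last by lin_tac.
  apply: eq_tbind => p1 p2.
  rewrite (tbind_linear (g := fun t => tbind t _)); last by lin_tac.
  rewrite /F; apply: eq_tbind => q1 q2; rewrite tbind_pure; last by lin_tac.
  rewrite twistorMr.
  rewrite (tbind_linear (g := fun t => tbind t _)); last by lin_tac.
  apply: eq_tbind => u1 u2.
  rewrite (tbind_linear (g := fun t => tbind t _)); last by lin_tac.
  apply: eq_tbind => v1 v2; rewrite tbind_pure; last by lin_tac.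
  by rewrite amulA.
- by move=> ? ?; rewrite /F; lin_tac.
- by move=> ? ?; rewrite /F; lin_tac.
- by move=> ? ?; rewrite /F; lin_tac.
Qed.

Fact lractTA d x d' : ractT (lactT d x) d' = lactT d (ractT x d').
Proof.
apply: (@tensor_ext_lin _ (fun x => ractT (lactT d x) d')
  (fun x => lactT d (ractT x d'))) x => [||a b].
- exact/lin_ract/lin_lact/lin_id.
- exact/lin_lact/lin_ract/lin_id.
rewrite lactTE ractTE.
rewrite (tbind_linear (g := ractT^~ d')); last exact/lin_ract/lin_id.
rewrite (tbind_linear (g := lactT d)); last exact/lin_lact/lin_id.
pose M (p1 p2 x1 x2 : D) := tbind (T (p1 ⊗ₜ x1)) (fun y1 y2 =>
  tbind (T (p2 ⊗ₜ x2)) (fun v1 v2 =>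
  tbind (T (y1 ⊗ₜ v2)) (fun w1 w2 => (w1 ∙ v1) ⊗ₜ (y2 ∙ w2)))).
transitivity (tbind (T (d ⊗ₜ a)) (fun p1 p2 =>
  tbind (T (b ⊗ₜ d')) (M p1 p2))).
  apply: eq_tbind => p1 p2.
  rewrite (tbind_linear (g := ractT^~ d')); last exact/lin_ract/lin_id.
  pose F (q u v : D) := tbind (T (p2 ⊗ₜ v)) (fun v1 v2 =>
    tbind (T (q ⊗ₜ v2)) (fun w1 w2 => (w1 ∙ v1) ⊗ₜ (u ∙ w2))).
  transitivity (tbind (T (p1 ⊗ₜ b)) (fun q1 q2 =>
    tbind (T (q2 ⊗ₜ d')) (fun u1 u2 => F q1 u1 u2))).
    apply: eq_tbind => q1 q2; rewrite ractTE.
    apply: eq_tbind => u1 u2; rewrite twistorMl.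
    rewrite (tbind_linear (g := fun t => tbind t _)); last by lin_tac.
    apply: eq_tbind => v1 v2.
    rewrite (tbind_linear (g := fun t => tbind t _)); last by lin_tac.
    by apply: eq_tbind => w1 w2; rewrite tbind_pure //; lin_tac.
  rewrite -(twistorC T (F := F)) //.
  - by move=> ? ?; rewrite /F; lin_tac.
  - by move=> ? ?; rewrite /F; lin_tac.
  - by move=> ? ?; rewrite /F; lin_tac.
rewrite tbindC; apply: eq_tbind => x1 x2.
rewrite (tbind_linear (g := lactT d)); last exact/lin_lact/lin_id.
pose G (u v q : D) := tbind (T (u ⊗ₜ x1)) (fun v1 v2 =>
  tbind (T (v1 ⊗ₜ q)) (fun w1 w2 => (w1 ∙ v) ⊗ₜ (v2 ∙ w2))).
transitivity (tbind (T (d ⊗ₜ a)) (fun r1 r2 =>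
  tbind (T (r2 ⊗ₜ x2)) (fun s1 s2 => G r1 s1 s2))).
  by apply: eq_tbind => p1 p2; rewrite /M tbindC.
rewrite -(twistorC T (F := G)).
- apply: eq_tbind => q1 q2; rewrite lactTE.
  apply: eq_tbind => u1 u2; rewrite twistorMr.
  rewrite (tbind_linear (g := fun t => tbind t _)); last by lin_tac.
  apply: eq_tbind => v1 v2.
  rewrite (tbind_linear (g := fun t => tbind t _)); last by lin_tac.
  by apply: eq_tbind => w1 w2; rewrite tbind_pure //; lin_tac.
- by move=> ? ?; rewrite /G; lin_tac.
- by move=> ? ?; rewrite /G; lin_tac.
- by move=> ? ?; rewrite /G; lin_tac.
Qed.

Lemma mulTA (x : D ⊗ D ⊗ D) : mulT (mul12 x) = mulT (mul23 x).
Proof.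
apply: (@tensor_extl _ _ _ _ _ (@mulT k D \o @mul12 k D)
  (@mulT k D \o @mul23 k D)) => a b c.
by rewrite /= mul12E mul23E !mulTE amulA.
Qed.

Lemma mul12_pure (x : D ⊗ D) c : mul12 (x ⊗ₜ c) = mulT x ⊗ₜ c.
Proof. exact: tmapE. Qed.
Lemma mul23_pure a (x : D ⊗ D) : mul23 (@tassocI k D D D (a ⊗ₜ x)) = a ⊗ₜ mulT x.
Proof.
exact: etrans (congr1 (tmap idfun (@mulT k D)) (tassocIK _)) (tmapE _ _ _ _).
Qed.

Fact mulT_lact d x : mulT (lactT d x) = mulT (T (d ⊗ₜ mulT x)).
Proof. by rewrite /lactT mulTA twistor_mul23 mul23_pure. Qed.
Fact mulT_ract x d : mulT (ractT x d) = mulT (T (mulT x ⊗ₜ d)).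
Proof. by rewrite /ractT -mulTA twistor_mul12 mul12_pure. Qed.
End TwistedProduct.

(* The algebra D^T: an alias of D, so that T selects the product. *)
Definition twisted_alg (k : fieldType) (D : assocAlgType k) (T : twistor D)
  : Type := D.

Section TwistedAlgebra.
Variables (k : fieldType) (D : assocAlgType k) (T : twistor D).
HB.instance Definition _ := GRing.Lmodule.copy (twisted_alg T) D.
HB.instance Definition _ := Lmodule_isAssocAlgebra.Build k (twisted_alg T)
  (@twisted_mulA k D T) (@twisted_mul1x k D T) (@twisted_mulx1 k D T)
  (@twisted_mulPl k D T) (@twisted_mulPr k D T).
End TwistedAlgebra.

Section KernelOfMul.
Variables (k : fieldType) (D : assocAlgType k).

Definition ker_mul_pred : {pred D ⊗ D} := fun x => mulT x == 0.

Fact ker_mul_submod : submod_closed ker_mul_pred.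
Proof.
split=> [|c x y]; first by rewrite unfold_in linear0.
by rewrite !unfold_in linearP /= => /eqP-> /eqP->; rewrite scaler0 addr0.
Qed.
HB.instance Definition _ :=
  GRing.isSubmodClosed.Build k (D ⊗ D) ker_mul_pred ker_mul_submod.

Record ker_mul := KerMul {
  ker_mul_val :> D ⊗ D; _ : ker_mul_val \in ker_mul_pred }.
HB.instance Definition _ := [isSub for ker_mul_val].
HB.instance Definition _ := [Choice of ker_mul by <:].
HB.instance Definition _ := [SubChoice_isSubLmodule of ker_mul by <:].

Lemma ker_mulP (x : ker_mul) : mulT (val x) = 0.
Proof. exact/eqP/(valP x). Qed.

Fact canonical_der_subproof (d : D) :
  d ⊗ₜ \1 - \1 ⊗ₜ d \in ker_mul_pred.
Proof. by rewrite unfold_in linearB /= !mulTE amul1x amulx1 subrr. Qed.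

Definition canonical_der (d : D) : ker_mul := KerMul (canonical_der_subproof d).
End KernelOfMul.

Record bimodule (k : fieldType) (A : assocAlgType k) (M : lmodType k) :=
  Bimodule {
  lact : A -> M -> M;
  ract : M -> A -> M;
  lact_bilinear : bilin lact;
  ract_bilinear : bilin ract;
  lact1 : forall m, lact \1 m = m;
  ract1 : forall m, ract m \1 = m;
  lactA : forall a b m, lact a (lact b m) = lact (a ∙ b) m;
  ractA : forall a b m, ract (ract m a) b = ract m (a ∙ b);
  lractA : forall a b m, ract (lact a m) b = lact a (ract m b)
}.

Definition is_derivation (k : fieldType) (A : assocAlgType k) (M : lmodType k)
    (B : bimodule A M) (delta : A -> M) : Prop :=
  linear delta /\
  forall a b : A, delta (a ∙ b) = lact B a (delta b) + ract B (delta a) b.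

Section KernelBimodule.
Variables (k : fieldType) (D : assocAlgType k) (T : twistor D).

Fact ker_lact_subproof (d : D) (x : ker_mul D) :
  lactT T d (val x) \in @ker_mul_pred k D.
Proof. by rewrite unfold_in mulT_lact ker_mulP linear0r !linear0. Qed.
Fact ker_ract_subproof (x : ker_mul D) (d : D) :
  ractT T (val x) d \in @ker_mul_pred k D.
Proof. by rewrite unfold_in mulT_ract ker_mulP linear0l !linear0. Qed.

Definition ker_lact (d : twisted_alg T) (x : ker_mul D) : ker_mul D :=
  KerMul (ker_lact_subproof d x).
Definition ker_ract (x : ker_mul D) (d : twisted_alg T) : ker_mul D :=
  KerMul (ker_ract_subproof x d).

Fact ker_lact_bilinear : bilin ker_lact.
Proof.
split=> [x c d d'|d c x y]; apply: val_inj.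
  exact: (fst (lactT_bilinear T)).
exact: (snd (lactT_bilinear T)).
Qed.
Fact ker_ract_bilinear : bilin ker_ract.
Proof.
split=> [d c x y|x c d d']; apply: val_inj.
  exact: (fst (ractT_bilinear T)).
exact: (snd (ractT_bilinear T)).
Qed.
Fact ker_lact1 x : ker_lact \1 x = x.
Proof. by apply: val_inj; apply: lactT1. Qed.
Fact ker_ract1 x : ker_ract x \1 = x.
Proof. by apply: val_inj; apply: ractT1. Qed.
Fact ker_lactA d d' x : ker_lact d (ker_lact d' x) = ker_lact (d ∙ d') x.
Proof. by apply: val_inj; apply: lactTA. Qed.
Fact ker_ractA d d' x : ker_ract (ker_ract x d) d' = ker_ract x (d ∙ d').
Proof. by apply: val_inj; apply: ractTA. Qed.
Fact ker_lractA d d' x :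
  ker_ract (ker_lact d x) d' = ker_lact d (ker_ract x d').
Proof. by apply: val_inj; apply: lractTA. Qed.

Definition ker_bimodule : bimodule (twisted_alg T) (ker_mul D) :=
  Bimodule ker_lact_bilinear ker_ract_bilinear ker_lact1 ker_ract1
    ker_lactA ker_ractA ker_lractA.
End KernelBimodule.

(* Main.v *)
(** The four values of the actions on the two halves of [δ] are
    [d → (d' ⊗ 1) = (d * d') ⊗ 1], [d → (1 ⊗ d') = T (d ⊗ d')],
    [(d ⊗ 1) ← d' = T (d ⊗ d')] and [(1 ⊗ d) ← d' = 1 ⊗ (d * d')];
    in [d → δ d' + δ d ← d'] the two copies of [T (d ⊗ d')] cancel. *)

Require Import Defs.
From mathcomp Require Import all_boot all_order all_algebra.

Set Implicit Arguments.
Unset Strict Implicit.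
Unset Printing Implicit Defensive.

Import GRing.Theory.
Local Open Scope ring_scope.

Section ActionsOnUnitTensors.
Variables (k : fieldType) (D : assocAlgType k) (T : twistor D).
Implicit Types a b d : D.

(** Lets a bare [T (d ⊗ₜ b)] be expanded into a [tbind], so that it can be compared summand by
    summand. *)
Lemma tbind_tpure (U V : lmodType k) (x : U ⊗ V) :
  tbind x (fun u v => u ⊗ₜ v) = x.
Proof. exact/esym/(tbindE (idfun : {linear U ⊗ V -> U ⊗ V})). Qed.

(** Of the two twists in the action, the second meets [\1] and is trivial. *)
Lemma lactT_tensor1 d a : lactT T d (a ⊗ₜ \1) = twisted_mul T d a ⊗ₜ \1.
Proof.
rewrite lactTE twisted_mulE.
rewrite (tbind_linear (g := fun w : D => w ⊗ₜ \1)); last by lin_tac.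
apply: eq_tbind => u v; rewrite twistor1r tbind_pure //; lin_tac.
Qed.

(** Here the first twist is the trivial one, and the final product is by [\1]. *)
Lemma lactT_1tensor d b : lactT T d (\1 ⊗ₜ b) = T (d ⊗ₜ b).
Proof.
rewrite lactTE twistor1r tbind_pure; last by lin_tac.
rewrite -[RHS]tbind_tpure; apply: eq_tbind => u v; by rewrite amulx1.
Qed.

Lemma ractT_tensor1 a d : ractT T (a ⊗ₜ \1) d = T (a ⊗ₜ d).
Proof.
rewrite ractTE twistor1l tbind_pure; last by lin_tac.
rewrite -[RHS]tbind_tpure; apply: eq_tbind => u v; by rewrite amul1x.
Qed.

Lemma ractT_1tensor b d : ractT T (\1 ⊗ₜ b) d = \1 ⊗ₜ twisted_mul T b d.
Proof.
rewrite ractTE twisted_mulE.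
rewrite (tbind_linear (g := fun w : D => \1 ⊗ₜ w)); last by lin_tac.
apply: eq_tbind => u v; rewrite twistor1l tbind_pure //; lin_tac.
Qed.

Lemma lactTB d x y : lactT T d (x - y) = lactT T d x - lactT T d y.
(* The difference is put in the form [c *: y + x] with [c = -1] to match bilinearity. *)
Proof. by rewrite ![_ - _]addrC -(scaleN1r y) (lactT_bilinear T).2 /= scaleN1r. Qed.

Lemma ractTB x y d : ractT T (x - y) d = ractT T x d - ractT T y d.
Proof. by rewrite ![_ - _]addrC -(scaleN1r y) (ractT_bilinear T).1 /= scaleN1r. Qed.

End ActionsOnUnitTensors.

Theorem proposition5p6 (k : fieldType) (D : assocAlgType k) (T : twistor D) :
  is_derivation (ker_bimodule T) (@canonical_der k D).
Proof.
split=> [c a b|a b]; apply: val_inj.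
  by rewrite linearP /= linearPl linearPr /= scalerBr opprD addrACA.
rewrite linearD /= lactTB ractTB lactT_tensor1 lactT_1tensor ractT_tensor1.
(* The product on the left is that of [twisted_alg T], convertible to [twisted_mul T a b]. *)
by rewrite ractT_1tensor addrA subrK.
Qed.
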